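(* Let $D$ be a complete division ring of characteristic $0$. For any $n>0$ and any monomial $p_n(x)=a_0xa_1x\cdots xa_n$ ($a_0,\dots,a_n\in D$) of power $n$ in one variable over $D$, $$\partial^np_n(x)(h)=n!\,p_n(h)$$ for all $x,h\in D$.
   Context: A complete division ring of characteristic $0$ is a division ring $D$ of characteristic $0$ with an absolute value $|\cdot|:D\to\mathbb R$ ($|a|\ge0$, $|a|=0$ iff $a=0$, $|ab|=|a||b|$, $|a+b|\le|a|+|b|$), complete for the metric $|a-b|$, such that the embedding of the rational field $\mathbb Q$ (usual topology) into $D$ is a homeomorphism onto its image; then $\mathbb R$ is a subfield of the center $Z(D)$. A map $f:D\to D$ is differentiable in the Gâteaux sense if at every $x$ one has $f(x+a)-f(x)=\partial f(x)(a)+o(a)$, where $a\mapsto\partial f(x)(a)$ is linear (additive and homogeneous over $Z(D)$) and $o$ is a continuous map with $|o(a)|/|a|\to0$ as $a\to0$; then $\partial f(x)(a)=\lim_{t\to0,\,t\in\mathbb R}t^{-1}(f(x+ta)-f(x))$. Higher derivatives: $\partial^0f(x)=f(x)$ and $\partial^nf(x)(h_1;\dots;h_n)=\partial\big(\partial^{n-1}f(x)(h_1;\dots;h_{n-1})\big)(h_n)$, the outer $\partial$ being taken with respect to $x$. Notation: $\partial^nf(x)(h)=\partial^nf(x)(h;\dots;h)$ ($n$ copies of $h$). *)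

(* Defs.v *)
From HB Require Import structures.
From mathcomp Require Import all_boot all_order all_algebra.
From mathcomp Require Import all_classical all_reals all_analysis.

Set Implicit Arguments.
Unset Strict Implicit.
Unset Printing Implicit Defensive.

Import Order.TTheory GRing.Theory Num.Theory.
Import numFieldNormedType.Exports.

Local Open Scope classical_set_scope.
Local Open Scope ring_scope.

(* [f] is a homeomorphism onto its image, the latter with the topology induced
   by [Y]. *)
Definition topological_embedding (X Y : topologicalType) (f : X -> Y) : Prop :=
  [/\ injective f, continuous f &
      forall A : set X, open A ->
        exists2 B : set Y, open B & f @` A = B `&` range f].

(* The MathComp norm (normedZmodType) is not used because it requires
   `|x *+ n| = `|x| *+ n, which a multiplicative absolute value need not satisfy
   (e.g. the square root of the usual one on the reals). *)
Record absValue (R : realType) (D : unitRingType) := AbsValue {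
  absv :> D -> R ;
  absv_ge0 : forall x, 0 <= absv x ;
  absv_eq0 : forall x, absv x = 0 <-> x = 0 ;
  absvM : forall x y, absv (x * y) = absv x * absv y ;
  absv_triangle : forall x y, absv (x + y) <= absv x + absv y }.

(* The carrier of [D] as a metric space for the distance [v (x - y)]. It is an
   alias because MathComp-Analysis has no structure joining a ring with a metric
   space that is not a normed module. *)
Definition absSpace (R : realType) (D : unitRingType) (v : absValue R D) : Type
  := D.

Section AbsSpaceMetric.
Variables (R : realType) (D : unitRingType) (v : absValue R D).

Lemma absv0 : v 0 = 0.
Proof. exact/(absv_eq0 v). Qed.

Lemma absv1 : v 1 = 1.
Proof.
have v1_neq0 : v 1 != 0.
  by apply/eqP => /(absv_eq0 v)/eqP; rewrite oner_eq0.
by apply: (mulfI v1_neq0); rewrite -absvM !mulr1.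
Qed.

Lemma absvN x : v (- x) = v x.
Proof.
suff vN1 : v (- 1) = 1 by rewrite -mulN1r absvM vN1 mul1r.
by apply/eqP; rewrite -sqrp_eq1 ?absv_ge0// expr2 -absvM mulrNN mulr1 absv1.
Qed.

Let dist (x y : absSpace v) : R := v ((x : D) - (y : D)).

Let distxx x : dist x x = 0.
Proof. by rewrite /dist subrr absv0. Qed.

Let dist_positivity x y : dist x y = 0 -> x = y.
Proof. by move=> /(absv_eq0 v)/eqP; rewrite subr_eq0 => /eqP. Qed.

Let dist_sym x y : dist x y = dist y x.
Proof. by rewrite /dist -absvN opprB. Qed.

Let dist_triangle y x z : dist x z <= dist x y + dist y z.
Proof. by apply: le_trans (absv_triangle v _ _); rewrite addrA subrK. Qed.

HB.instance Definition _ := Choice.copy (absSpace v) D.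
HB.instance Definition _ := isPointed.Build (absSpace v) (0 : D).
HB.instance Definition _ := isMetric.Build R (absSpace v)
  distxx dist_positivity dist_sym dist_triangle.

End AbsSpaceMetric.

(* Division rings are not in MathComp: the first field makes the (possibly non
   commutative) [unitRingType] [D] one. In the last field [rat^o] is the field
   of rationals with its usual topology. *)
Record complete_division_ring (R : realType) (D : unitRingType)
    (v : absValue R D) : Prop := {
  cdr_unit : forall x : D, x != 0 -> x \is a GRing.unit ;
  cdr_pchar0 : [pchar D] =i pred0 ;
  cdr_complete : forall F : set_system (absSpace v),
    ProperFilter F -> cauchy F -> cvg F ;
  cdr_rat : topological_embedding (ratr : rat^o -> absSpace v) }.

Section Gateaux.
Context {R : realType} {D : unitRingType} (v : absValue R D).
Implicit Types (f L o : D -> D) (x h : D).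

Definition center_linear L : Prop :=
  {morph L : a b / a + b} /\
  (forall c, (forall y, GRing.comm c y) -> forall a, L (c * a) = c * L a).

Definition is_gateaux f x L : Prop :=
  center_linear L /\
  exists o, [/\ continuous (o : absSpace v -> absSpace v),
    v (o a) / v a @[a --> ((0 : D) : absSpace v)^'] --> (0 : R) &
    forall a, f (x + a) - f x = L a + o a].

Definition gateaux_differentiable f : Prop :=
  forall x, exists L, is_gateaux f x L.

(* Junk value [0] where [f] has no derivative. *)
Definition gateaux f x : D -> D := xget (fun=> 0) [set L | is_gateaux f x L].

(* [gateauxn f [:: h1; ...; hn] x] is d^n f(x)(h1; ...; hn): each further
   increment differentiates, with respect to x, the function of x obtained so
   far. *)
Definition gateauxn f (hs : seq D) : D -> D :=
  foldl (fun g h => fun x => gateaux g x h) f hs.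

(* All derivatives of order at most [n], along all increments, exist. *)
Definition gateaux_differentiablen (n : nat) f : Prop :=
  forall hs : seq D, (size hs < n)%N -> gateaux_differentiable (gateauxn f hs).

End Gateaux.

(* a_0 x a_1 x ... x a_n *)
Definition monomial (D : unitRingType) (n : nat) (a : 'I_n.+1 -> D) (x : D) : D
  := a ord0 * \prod_(i < n) (x * a (lift ord0 i)).

(* Main.v *)
Require Import Defs.
From mathcomp Require Import all_boot all_order all_algebra.
From mathcomp Require Import all_classical all_reals all_analysis.

Set Implicit Arguments.
Unset Strict Implicit.
Unset Printing Implicit Defensive.

Import Order.TTheory GRing.Theory Num.Theory.
Import numFieldNormedType.Exports.

Local Open Scope ring_scope.
Local Open Scope classical_set_scope.

(** A monomial is a generalized polynomial: an expression built from constants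
    of [D] and one variable by sums and noncommutative products. Such an
    expression [p] has a symbolic derivative [gderiv p h] along [h], given by
    the Leibniz rule, which is again a generalized polynomial in [x]. The proof
    splits into an analytic and an algebraic half.

    The analytic half shows that the symbolic derivative is the Gateaux
    derivative, so that iterated Gateaux derivatives are iterated symbolic ones
    ([gateauxn_gfun]). Existence follows from a quadratic bound, in
    [|h| <= 1], on the remainder [p (x + h) - p x - gderiv p h x]
    ([gderiv_remainder]), which the Leibniz rule propagates through products
    ([is_gateaux_gderiv]). Uniqueness ([is_gateaux_unique]) is the usual
    rescaling argument: if [L] is homogeneous over the center and
    [|L a| = o(|a|)], then [|L h| / |h| = |L (t h)| / |t h|] for central
    [t != 0], and this tends to [0] with [t]; nonzero central elements of
    arbitrarily small absolute value exist because [Q] embeds in [D] with its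
    usual topology.

    The algebraic half restricts an expression to the line through [x] with
    direction [h]: substituting [x + h X] for the variable gives a polynomial in
    [{poly D}], whose indeterminate [X] commutes with all of [D]. The symbolic
    derivative along [h] becomes the formal derivative with respect to [X], and
    evaluation at [x] becomes the constant coefficient. Hence the [n]-th
    derivative at [x] along [h] is [n!] times the coefficient of [X^n]
    ([iter_gderivE]). In [a_0 (x + h X) a_1 (x + h X) ... a_n] this coefficient
    is obtained by taking [h X] from each of the [n] factors, so it is
    [a_0 h a_1 h ... a_n], whatever [x] is. *)

(** * Generalized polynomials and their symbolic derivatives *)

Inductive gpoly (D : Type) : Type :=
  | Const of D
  | Var
  | Add of gpoly D & gpoly D
  | Mul of gpoly D & gpoly D.
Arguments Var {D}.

(** The target ring [S] is arbitrary because two evaluations are needed: in [D]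
    itself, to get functions, and in [{poly D}], to restrict to lines. *)
Fixpoint geval (D : Type) (S : nzRingType) (c : D -> S) (y : S) (p : gpoly D)
    : S :=
  match p with
  | Const d => c d
  | Var => y
  | Add p q => geval c y p + geval c y q
  | Mul p q => geval c y p * geval c y q
  end.

Fixpoint gderiv (D : nzRingType) (p : gpoly D) (h : D) : gpoly D :=
  match p with
  | Const _ => Const 0
  | Var => Const h
  | Add p q => Add (gderiv p h) (gderiv q h)
  | Mul p q => Add (Mul (gderiv p h) q) (Mul p (gderiv q h))
  end.

Definition gfun (D : nzRingType) (p : gpoly D) (x : D) : D := geval id x p.

Definition gmonomial (D : nzRingType) (n : nat) (a : 'I_n.+1 -> D) : gpoly D :=
  Mul (Const (a ord0))
    (foldr (fun i => Mul (Mul Var (Const (a (lift ord0 i))))) (Const 1)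
       (index_enum 'I_n)).

Lemma geval_gmonomial (D S : nzRingType) (c : {rmorphism D -> S}) (n : nat)
    (a : 'I_n.+1 -> D) (y : S) :
  geval c y (gmonomial a) =
    c (a ord0) * \prod_(i < n) (y * c (a (lift ord0 i))).
Proof.
rewrite /gmonomial /=; congr (_ * _).
elim: (index_enum _) => [|i s IHs] /=; first by rewrite big_nil rmorph1.
by rewrite big_cons IHs.
Qed.

(** * Restriction to a line *)

Definition line (D : nzRingType) (x h : D) : {poly D} := x%:P + h%:P * 'X.

Lemma coef0_geval_line (D : nzRingType) (p : gpoly D) (x h : D) :
  (geval polyC (line x h) p)`_0 = gfun p x.
Proof.
rewrite /gfun; elim: p => [d||p IHp q IHq|p IHp q IHq] /=.
- by rewrite coefC.
- by rewrite /line coefD coefC coefMX addr0.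
- by rewrite coefD IHp IHq.
- by rewrite coef0M IHp IHq.
Qed.

(** Both derivatives obey the Leibniz rule, which holds in [{poly D}] even for
    noncommutative [D], and both send the variable to [h]. *)
Lemma deriv_geval_line (D : nzRingType) (p : gpoly D) (x h : D) :
  deriv (geval polyC (line x h) p) = geval polyC (line x h) (gderiv p h).
Proof.
elim: p => [d||p IHp q IHq|p IHp q IHq] /=.
- by rewrite derivC polyC0.
- by rewrite /line derivD derivM !derivC derivX mulr1 mul0r !add0r.
- by rewrite derivD IHp IHq.
- by rewrite derivM IHp IHq.
Qed.

(** Taylor's formula on the line: the constant coefficient of the [n]-th formal
    derivative is [n!] times the coefficient of [X^n]. *)
Lemma iter_gderivE (D : nzRingType) (p : gpoly D) (x h : D) (n : nat) :
  gfun (foldl (@gderiv D) p (nseq n h)) x =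
    (geval polyC (line x h) p)`_n *+ n`!.
Proof.
suff derivn_line m : derivn m (geval polyC (line x h) p) =
    geval polyC (line x h) (foldl (@gderiv D) p (nseq m h)).
  by rewrite -(coef0_geval_line _ x h) -derivn_line coef_derivn addn0 ffactnn.
elim: m p => [//|m IHm] p.
by rewrite derivSn deriv_geval_line IHm.
Qed.

(** Each factor has degree at most one in [X], so the coefficient of the highest
    possible power of [X] collects the linear term of every factor. *)
Lemma coef_prod_line (D : nzRingType) (I : Type) (s : seq I) (b : I -> D)
    (x h : D) :
  (\prod_(i <- s) (line x h * (b i)%:P))`_(size s) = \prod_(i <- s) (h * b i).
Proof.
have lineM i q k :
    (line x h * (b i)%:P * q)`_k.+1 = x * b i * q`_k.+1 + h * b i * q`_k.
  have -> : line x h * (b i)%:P = (x * b i)%:P + (h * b i)%:P * 'X.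
    by rewrite /line mulrDl !polyCM -[_ * 'X * _]mulrA -commr_polyX mulrA.
  rewrite mulrDl coefD coefCM -[_ * 'X * _]mulrA -commr_polyX mulrA coefMX.
  by rewrite coefCM.
(* The degree bound goes into the induction: it kills the contribution of the
   constant term [x * b i] to the top coefficient. *)
suff sz_coef :
    (size (\prod_(i <- s) (line x h * (b i)%:P))%R <= (size s).+1)%N /\
    (\prod_(i <- s) (line x h * (b i)%:P))`_(size s) =
    \prod_(i <- s) (h * b i).
  by case: sz_coef.
elim: s => [|i s [IHsz IHs]]; first by rewrite !big_nil size_poly1 coef1.
rewrite !big_cons /=; set q := \prod_(i <- s) _ in IHsz IHs *; split.
  apply/leq_sizeP => -[//|k] lt_sk.
  rewrite lineM !nth_default ?mulr0 ?addr0 //; apply: leq_trans IHsz _ => //.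
  exact: ltnW.
by rewrite lineM IHs nth_default // mulr0 add0r.
Qed.

Lemma iter_gderiv_gmonomial (D : nzRingType) (n : nat) (a : 'I_n.+1 -> D)
    (x h : D) :
  gfun (foldl (@gderiv D) (gmonomial a) (nseq n h)) x =
    n`!%:R * gfun (gmonomial a) h.
Proof.
rewrite iter_gderivE /gfun.
rewrite (geval_gmonomial (@polyC D)) (geval_gmonomial idfun) /= coefCM.
have := coef_prod_line (index_enum 'I_n) (fun i => a (lift ord0 i)) x h.
rewrite /index_enum -enumT size_enum_ord => ->.
by rewrite mulr_natl.
Qed.

(** * The symbolic derivative is a Gateaux derivative *)

Lemma center_linear_gderiv (D : unitRingType) (p : gpoly D) (x : D) :
  center_linear (fun h => gfun (gderiv p h) x).
Proof.
rewrite /gfun; elim: p => [d||p [pD pZ] q [qD qZ]|p [pD pZ] q [qD qZ]] /=.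
- by split=> [a b|c _ a] /=; rewrite ?addr0 ?mulr0.
- by split.
- split=> [a b|c cc a] /=; first by rewrite pD qD addrACA.
  by rewrite pZ // qZ // mulrDr.
- split=> [a b|c cc a] /=; first by rewrite pD qD mulrDl mulrDr addrACA.
  by rewrite pZ // qZ // mulrDr !mulrA (cc (geval id x p)).
Qed.

Section Estimates.
Context {R : realType} {D : unitRingType} (v : absValue R D).

Lemma gderiv_bounded (p : gpoly D) (x : D) :
  exists2 K : R, 0 <= K & forall h, v (gfun (gderiv p h) x) <= K * v h.
Proof.
rewrite /gfun.
elim: p => [d||p [K K0 IHp] q [K' K'0 IHq]|p [K K0 IHp] q [K' K'0 IHq]] /=.
- by exists 0 => // h; rewrite absv0 mul0r.
- by exists 1 => // h; rewrite mul1r.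
- exists (K + K'); first exact: addr_ge0.
  by move=> h; apply: le_trans (absv_triangle v _ _) _; rewrite mulrDl lerD.
- exists (K * v (geval id x q) + v (geval id x p) * K').
    by rewrite addr_ge0 // mulr_ge0 // absv_ge0.
  move=> h; apply: le_trans (absv_triangle v _ _) _.
  rewrite mulrDl !absvM; apply: lerD.
    by rewrite mulrAC ler_wpM2r ?absv_ge0.
  by rewrite -mulrA ler_wpM2l ?absv_ge0.
Qed.

(** A bounded linear part and a quadratic remainder make the increments of [f]
    linearly bounded on the unit ball, where [|h|^2 <= |h|]. *)
Lemma increment_bound (f L : D -> D) (x : D) (K C : R) :
  (forall h, v (L h) <= K * v h) ->
  (forall h, v h <= 1 -> v (f (x + h) - f x - L h) <= C * v h ^+ 2) ->
  0 <= C -> forall h, v h <= 1 -> v (f (x + h) - f x) <= (K + C) * v h.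
Proof.
move=> Lb rb C0 h h1; rewrite -[f (x + h) - f x](subrK (L h)).
apply: le_trans (absv_triangle v _ _) _; rewrite mulrDl [leRHS]addrC lerD //.
apply: le_trans (rb h h1) _; rewrite ler_wpM2l // expr2 -[leRHS]mulr1.
by rewrite ler_wpM2l ?absv_ge0.
Qed.

(** For a product, with [dp] and [dq] the symbolic derivatives, the remainder is
    [(P (x + h) - P x - dp) Q x + P x (Q (x + h) - Q x - dq)
      + (P (x + h) - P x) (Q (x + h) - Q x)]: the first two terms are quadratic
    by induction, the third as a product of two linearly bounded increments. *)
Lemma gderiv_remainder (p : gpoly D) (x : D) :
  exists2 C : R, 0 <= C & forall h, v h <= 1 ->
    v (gfun p (x + h) - gfun p x - gfun (gderiv p h) x)
      <= C * v h ^+ 2.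
Proof.
elim: p => [d||p [C C0 IHp] q [C' C'0 IHq]|p [C C0 IHp] q [C' C'0 IHq]].
- by exists 0 => // h _; rewrite /gfun /= subrr subrr absv0 mul0r.
- by exists 0 => // h _; rewrite /gfun /= [x + h]addrC addrK subrr absv0 mul0r.
- exists (C + C'); first exact: addr_ge0.
  move=> h h1; rewrite mulrDl.
  apply: le_trans (lerD (IHp h h1) (IHq h h1)).
  apply: le_trans (absv_triangle v _ _).
  by rewrite /gfun /= !opprD !addrA (ACl (1*3*5*2*4*6)).
- have [K K0 Kp] := gderiv_bounded p x; have [K' K'0 Kq] := gderiv_bounded q x.
  have incp := increment_bound Kp IHp C0.
  have incq := increment_bound Kq IHq C'0.
  pose P := gfun p; pose Q := gfun q.
  exists (C * v (Q x) + v (P x) * C' + (K + C) * (K' + C')).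
    by rewrite !addr_ge0 ?mulr_ge0 ?addr_ge0 ?absv_ge0.
  move=> h h1.
  have -> : gfun (Mul p q) (x + h) - gfun (Mul p q) x -
      gfun (gderiv (Mul p q) h) x =
      (P (x + h) - P x - gfun (gderiv p h) x) * Q x +
      P x * (Q (x + h) - Q x - gfun (gderiv q h) x) +
      (P (x + h) - P x) * (Q (x + h) - Q x).
    rewrite {1 2 3}/gfun /= -!/(gfun _ _) -/P -/Q.
    set dp := gfun _ _; set dq := gfun _ _.
    move: (P (x + h)) (P x) (Q (x + h)) (Q x) dp dq => P' P0 Q' Q0 dp dq.
    have -> : P' * Q' - P0 * Q0 = (P' - P0) * Q0 + P0 * (Q' - Q0) +
        (P' - P0) * (Q' - Q0).
      by rewrite addrAC -mulrDr subrKC mulrBl mulrBr addrA subrK.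
    rewrite [(_ - dp) * _]mulrBl [_ * (_ - dq)]mulrBr addrACA -opprD.
    exact: addrAC.
  rewrite [leRHS]mulrDl; apply: le_trans (absv_triangle v _ _) _; apply: lerD.
    rewrite [leRHS]mulrDl; apply: le_trans (absv_triangle v _ _) _.
    apply: lerD; rewrite absvM.
      by rewrite mulrAC ler_wpM2r ?absv_ge0 // IHp.
    by rewrite -mulrA ler_wpM2l ?absv_ge0 // IHq.
  rewrite absvM expr2 mulrACA.
  by rewrite ler_pM ?absv_ge0 ?incp ?incq.
Qed.


Lemma absSpace_ballE (x y : absSpace v) (e : R) :
  ball x e y = (v ((x : D) - (y : D)) < e) :> Prop.
Proof. by rewrite ballEmdist. Qed.

Lemma continuous_local_Lipschitz (f : D -> D) :
  (forall x, exists2 K : R, 0 <= K & forall h, v h <= 1 ->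
     v (f (x + h) - f x) <= K * v h) ->
  continuous (f : absSpace v -> absSpace v).
Proof.
move=> flip x; have [K K0 Kx] := flip x.
apply/(@cvg_ballP _ _ _ _ (nbhs_filter (x : absSpace v))) => e e0.
apply/nbhs_ballP.
(* [K + 1] rather than [K], which may vanish. *)
exists (Num.min 1 (e / (K + 1))) => /=.
  by rewrite lt_min ltr01 divr_gt0 // ltr_wpDl.
move=> y /=; rewrite !absSpace_ballE -absvN opprB lt_min => /andP[/ltW y1 ye].
rewrite -absvN opprB.
have := Kx _ y1; rewrite [x + _]addrC subrK => /le_lt_trans; apply.
rewrite ltr_pdivlMr ?ltr_wpDl // in ye.
by apply: le_lt_trans ye; rewrite mulrC ler_wpM2l ?absv_ge0 // lerDl.
Qed.

(** The remainder [o h = p (x + h) - p x - gderiv p h x] is small by the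
    quadratic bound; it is continuous because its own increments are those of
    [p] at [x + y] minus the linear part, hence locally Lipschitz. *)
Lemma is_gateaux_gderiv (p : gpoly D) (x : D) :
  is_gateaux v (gfun p) x (fun h => gfun (gderiv p h) x).
Proof.
pose L h := gfun (gderiv p h) x.
have incr y : exists2 K : R, 0 <= K & forall h, v h <= 1 ->
    v (gfun p (y + h) - gfun p y) <= K * v h.
  have [C C0 pC] := gderiv_remainder p y; have [K K0 pK] := gderiv_bounded p y.
  by exists (K + C); [exact: addr_ge0|exact: increment_bound pK pC C0].
have linL := center_linear_gderiv p x; split=> //.
exists (fun h => gfun p (x + h) - gfun p x - L h); split.
- apply: continuous_local_Lipschitz => y; have [K K0 Kxy] := incr (x + y).
  have [K' K'0 LK'] := gderiv_bounded p x.
  exists (K + K') => [|h h1]; first exact: addr_ge0.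
  have -> : L (y + h) = L y + L h by exact: linL.1.
  rewrite (_ : _ - _ - _ - _ = (gfun p (x + y + h) - gfun p (x + y)) +
    - L h).
    rewrite mulrDl (le_trans (absv_triangle v _ _)) // lerD ?Kxy //.
    by rewrite absvN LK'.
  rewrite !opprD !opprK !addrA (ACl (1*5*4*(2*6)*(3*7))) /=.
  by rewrite !addNr !addr0.
- have [C C0 pC] := gderiv_remainder p x.
  apply/cvgrPdist_lt => e e0; apply/nbhs_ballP.
  exists (Num.min 1 (e / (C + 1))) => /=.
    by rewrite lt_min ltr01 divr_gt0 // ltr_wpDl.
  move=> h; rewrite absSpace_ballE sub0r absvN lt_min.
  move=> /andP[/ltW h1 he] /eqP h_neq0.
  have vh_gt0 : 0 < v h.
    by rewrite lt_def absv_ge0 andbT; apply/eqP => /(absv_eq0 v).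
  rewrite sub0r normrN ger0_norm ?divr_ge0 ?absv_ge0 //.
  rewrite ltr_pdivrMr //; apply: le_lt_trans (pC h h1) _.
  rewrite expr2 mulrA ltr_pM2r //; rewrite ltr_pdivlMr ?ltr_wpDl // in he.
  by apply: le_lt_trans he; rewrite mulrC ler_wpM2l ?absv_ge0 // lerDl.
- by move=> h; rewrite subrKC.
Qed.

(** * Uniqueness of the Gateaux derivative *)

Context (D_cdr : complete_division_ring v).

(** The witnesses are rationals: they are central, nonzero ones stay nonzero
    by injectivity of the embedding, and its continuity at [0] makes them
    small. *)
Lemma small_central (e : R) : 0 < e ->
  exists t : D, [/\ t != 0, forall y, GRing.comm t y & v t < e].
Proof.
move=> e0; have [inj_rat cont_rat _] := cdr_rat D_cdr.
have rat0 : (ratr (0 : rat) : D) = 0 by rewrite /ratr /= mul0r.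
have small_rat : \forall q \near (0 : rat^o)^', v (ratr q : D) < e.
  apply: cvg_within; have /cvg_ballP/(_ _ e0) := cont_rat (0 : rat^o).
  apply: filterS => q; by rewrite absSpace_ballE rat0 sub0r absvN.
have [q [q_neq0 qe]] : exists q : rat^o, q != 0 /\ v (ratr q : D) < e.
  apply: (@filter_ex _ (0 : rat^o)^'); near=> q; split; last by near: q.
  by near: q; exact: nbhs_dnbhs_neq.
exists (ratr q); split=> //.
  by apply: contra q_neq0 => /eqP q0; apply/eqP/inj_rat; rewrite q0 rat0.
move=> y; apply/commr_sym; rewrite /ratr.
by apply: commrM; [exact: commr_int|apply/commrV/commr_int].
Unshelve. all: by end_near. Qed.

(** The difference [L1 - L2] is a difference of two remainders, hence [o(|a|)],
    while [|L1 a - L2 a| / |a|] does not change when [a] is multiplied by a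
    nonzero central element; shrinking [a] along such multiples forces it
    to be [0]. *)
Lemma is_gateaux_unique (f L1 L2 : D -> D) (x : D) :
  is_gateaux v f x L1 -> is_gateaux v f x L2 -> L1 = L2.
Proof.
move=> [[L1D L1Z] [r1 [_ r1_small fr1]]] [[L2D L2Z] [r2 [_ r2_small fr2]]].
apply/funext => h; have [->|h_neq0] := eqVneq h 0.
  have L0 L : {morph L : a b / a + b} -> L (0 : D) = 0 :> D.
    by move=> LD; apply: (addrI (L 0)); rewrite -LD !addr0.
  by rewrite !L0.
apply/eqP; rewrite -subr_eq0; apply/eqP/(absv_eq0 v)/eqP.
rewrite eq_le absv_ge0 andbT; apply/ler_addgt0Pl => /= e e0; rewrite addr0.
have v_gt0 y : y != 0 -> 0 < v y.
  by move=> y0; rewrite lt_def absv_ge0 andbT; apply: contra y0 =>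
    /eqP/(absv_eq0 v) ->.
have vh := v_gt0 _ h_neq0.
(* Each remainder gets half of [e], relative to [v h], as the estimate is
   made at [t * h] and then divided by [v t]. *)
have eh : 0 < e / v h / 2 by rewrite !divr_gt0.
have : \forall a \near ((0 : D) : absSpace v)^',
    v (r1 a) / v a < e / v h / 2 /\ v (r2 a) / v a < e / v h / 2.
  have ev o : v (o a) / v a @[a --> ((0 : D) : absSpace v)^'] --> (0 : R) ->
      \forall a \near ((0 : D) : absSpace v)^', v (o a) / v a < e / v h / 2.
    move/cvgrPdist_lt => /(_ _ eh); apply: filterS => a.
    by rewrite sub0r normrN; apply: le_lt_trans; exact: ler_norm.
  by apply: filterI; exact: ev.
move=> /nbhs_ballP[d /= d0 small].
have [t [t_neq0 t_central td]] := small_central (divr_gt0 d0 vh).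
have th_neq0 : t * h != 0.
  apply/eqP => /(absv_eq0 v); rewrite absvM => /eqP.
  by rewrite mulf_eq0 !gt_eqF ?v_gt0.
have [] := small (t * h).
- by rewrite absSpace_ballE sub0r absvN absvM -ltr_pdivlMr.
- exact: th_neq0.
have vt := v_gt0 _ t_neq0.
rewrite absvM !ltr_pdivrMr ?mulr_gt0 // => r1e r2e.
have : v (t * (L1 h - L2 h)) <= e * v t.
  rewrite mulrBr -L1Z // -L2Z //.
  have -> : L1 (t * h) - L2 (t * h) = r2 (t * h) - r1 (t * h).
    apply: (addIr (r1 (t * h))).
    by rewrite subrK addrAC -fr1 fr2 addrC addKr.
  apply: le_trans (absv_triangle v _ _) _; rewrite absvN.
  apply: le_trans (ltW (ltrD r2e r1e)) _.
  by rewrite -mulrDl -splitr mulrCA mulrC divfK ?gt_eqF // mulrC.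
by rewrite absvM mulrC ler_pM2r.
Qed.

(** * Iterated derivatives *)

Lemma gateaux_gfun (p : gpoly D) (x h : D) :
  gateaux v (gfun p) x h = gfun (gderiv p h) x.
Proof.
have /(xgetPex (fun=> 0)) : exists L, is_gateaux v (gfun p) x L.
  by eexists; exact: is_gateaux_gderiv.
by move=> /is_gateaux_unique/(_ (is_gateaux_gderiv p x)) /(congr1 (@^~ h)).
Qed.

Lemma gateauxn_gfun (p : gpoly D) (hs : seq D) :
  gateauxn v (gfun p) hs = gfun (foldl (@gderiv D) p hs).
Proof.
elim: hs p => [//|h hs IHhs] p; rewrite /gateauxn /= -IHhs.
congr foldl; apply/funext => x; exact: gateaux_gfun.
Qed.

End Estimates.

Theorem theorem9p5 (R : realType) (D : unitRingType) (v : absValue R D)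
    (D_cdr : complete_division_ring v) (n : nat) (n_gt0 : (0 < n)%N)
    (a : 'I_n.+1 -> D) :
  gateaux_differentiablen v n (monomial a) /\
  (forall x h : D,
     gateauxn v (monomial a) (nseq n h) x = n`!%:R * monomial a h).
Proof.
have -> : monomial a = gfun (gmonomial a).
  by apply/funext => x; rewrite /gfun (geval_gmonomial idfun).
split=> [hs _ x|x h]; rewrite (gateauxn_gfun D_cdr).
  by eexists; exact: is_gateaux_gderiv.
exact: iter_gderiv_gmonomial.
Qed.
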